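(* Let $A\in\mathbb{C}^{m\times n}$ with $m\ge n$, let $S_1\in\mathbb{C}^{m\times m}$ and $S_2\in\mathbb{C}^{n\times n}$ be skew-Hermitian, and let $E=S_1A+AS_2$. For each $i$, let $\sigma_i(0)$ and $\sigma_i(1)$ be the $i$-th singular values of $A$ and of $A+E$ respectively. Then $$|\sigma_i(1)-\sigma_i(0)|\le\frac12\left\|S_1^2A+2S_1AS_2+AS_2^2\right\|_2\le\frac12\|E\|_2\left(\|S_1\|_2+\|S_2\|_2\right).$$
   Context: $\|\cdot\|_2$ is the spectral norm. Singular values are listed with multiplicity in the same monotone order for $A$ and $A+E$, $1\le i\le n$. *)

(* Defs.v *)
From HB Require Import structures.
From mathcomp Require Import all_boot all_order all_algebra.
From mathcomp Require Import complex.
From mathcomp Require Import classical_sets reals.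

Set Implicit Arguments.
Unset Strict Implicit.
Unset Printing Implicit Defensive.

Import Order.TTheory GRing.Theory Num.Theory.
Local Open Scope ring_scope.
Local Open Scope classical_set_scope.
Local Open Scope sesquilinear_scope.

Definition skew_hermitian (R : rcfType) (n : nat) (S : 'M[R[i]]_n) : Prop :=
  S ^t* = - S.

Definition euclidean_norm (R : rcfType) (n : nat) (x : 'cV[R[i]]_n) : R :=
  Num.sqrt (\sum_(j < n) (complex.Re (x j 0) ^+ 2 + complex.Im (x j 0) ^+ 2)).

(* The operator norm induced by the Euclidean norms.  The unit ball, unlike the
   unit sphere, is nonempty also when n = 0. *)
Definition spectral_norm (R : realType) (m n : nat) (M : 'M[R[i]]_(m, n)) : R :=
  sup [set euclidean_norm (M *m x)
         | x in [set x : 'cV[R[i]]_n | euclidean_norm x <= 1]].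

(* The square roots of the n eigenvalues of A^* A, with multiplicity, in
   nonincreasing order.  [spectral_diag] lists the eigenvalues of a normal
   matrix in an unspecified order; those of A^* A are real and nonnegative
   (as elements of R[i]), so taking real parts loses nothing. *)
Definition singular_values (R : rcfType) (m n : nat) (A : 'M[R[i]]_(m, n)) :
    seq R :=
  sort >=%R
    [seq Num.sqrt (complex.Re (spectral_diag (A ^t* *m A) 0 j))
       | j <- enum 'I_n].

Definition singular_value (R : rcfType) (m n : nat) (A : 'M[R[i]]_(m, n))
    (i : 'I_n) : R :=
  nth 0 (singular_values A) i.

Lemma gram_normalmx (R : rcfType) m n (A : 'M[R[i]]_(m, n)) : (A ^t* *m A) \is normalmx.
Proof. by apply/normalmxP; rewrite trmx_mul map_mxM /= trmxCK. Qed.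

Lemma singular_values_sorted (R : rcfType) m n (A : 'M[R[i]]_(m, n)) :
  sorted >=%R (singular_values A) /\ size (singular_values A) = n.
Proof.
split; first by apply: (@sort_sorted _ >=%R) => x y; exact: le_total.
by rewrite size_sort size_map size_enum_ord.
Qed.

Lemma spectral_diag_gram_ge0 (R : rcfType) m n (A : 'M[R[i]]_(m, n)) j :
  0 <= spectral_diag (A ^t* *m A) 0 j.
Proof.
set D := spectral_diag _; set P := spectralmx (A ^t* *m A).
have PU : P \is unitarymx by exact: spectral_unitarymx.
have E : A ^t* *m A = P^t* *m diag_mx D *m P.
  have /orthomx_spectralP := gram_normalmx A; by rewrite -/P -/D invmx_unitary.
have E2 : (A *m P^t*)^t* *m (A *m P^t*) = diag_mx D.
  rewrite trmx_mul map_mxM /= trmxCK mulmxA -(mulmxA P) E !mulmxA.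
  by rewrite (unitarymxP PU) mul1mx -mulmxA (unitarymxP PU) mulmx1.
have := congr1 (fun M : 'M__ => M j j) E2; rewrite !mxE eqxx mulr1n => <-.
by apply: sumr_ge0 => k _; rewrite !mxE mulrC mul_conjC_ge0.
Qed.

Lemma char_poly_gram (R : rcfType) m n (A : 'M[R[i]]_(m, n)) :
  char_poly (A ^t* *m A) =
  \prod_(s <- singular_values A) ('X - ((s ^+ 2)%:C)%C%:P).
Proof.
rewrite (perm_big _ (permEl (perm_sort _ _))) /= big_map big_enum /=.
set P := spectralmx (A ^t* *m A); set D := spectral_diag (A ^t* *m A).
have /orthomx_spectralP E := gram_normalmx A; rewrite -/P -/D in E.
have PU : P \in unitmx by apply: spectral_unit.
have -> : char_poly (A ^t* *m A) = char_poly (diag_mx D).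
  rewrite E /char_poly /char_poly_mx; set f := map_mx polyC.
  have PV : f (invmx P) *m f P = 1%:M by rewrite /f -map_mxM mulVmx // map_mx1.
  have -> : 'X%:M - f (invmx P *m diag_mx D *m P) =
     f (invmx P) *m ('X%:M - f (diag_mx D)) *m f P.
    rewrite mulmxBr mulmxBl [f (invmx P) *m _%:M]scalar_mxC.
    rewrite -[_ *m f P]mulmxA PV mulmx1; congr (_ - _).
    by rewrite /f !map_mxM.
  by rewrite !det_mulmx mulrAC -det_mulmx PV det1 mul1r.
rewrite char_poly_trig ?diag_mx_is_trig //; apply: eq_bigr => j _.
rewrite mxE eqxx mulr1n; congr ('X - _%:P).
have := spectral_diag_gram_ge0 A j; rewrite -/D; case: (D 0 j) => a b.
by rewrite lecE /= => /andP[/eqP b0 a0]; rewrite b0 sqr_sqrtr.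
Qed.

(* Main.v *)
Require Import Defs.
From mathcomp Require Import all_boot all_order all_fingroup all_algebra.
From mathcomp Require Import complex boolp classical_sets functions reals ring lra.
From mathcomp Require Import topology normedtype derive realfun trigo.

Set Implicit Arguments.
Unset Strict Implicit.
Unset Printing Implicit Defensive.

Import Order.TTheory GRing.Theory Num.Theory.
Import numFieldNormedType.Exports.
Local Open Scope ring_scope.
Local Open Scope sesquilinear_scope.

(* The curve F(t) = e^(t S1) A e^(t S2) satisfies F(0) = A, F'(0) = E and
   F''(t) = e^(t S1) (S1 E + E S2) e^(t S2), and has the same singular values
   as A because both exponentials are unitary.  The second-order Taylor formula
   gives |F(1) x - (A + E) x| <= 1/2 |S1 E + E S2| |x|, and Weyl's inequality
   concludes.  The exponentials are written in eigenbases of S1 and S2, where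
   they are diagonal with entries e^(i t a), so that only derivatives of the
   scalar functions Re <y, F(t) x> are needed. *)

Local Notation "⟦ x ⟧" := (euclidean_norm x)
  (at level 0, x at level 99, format "⟦ x ⟧").

(** * The Euclidean norm on complex column vectors and its real inner product *)

Section EuclideanSpace.
Variable R : rcfType.
Local Notation C := R[i].

Lemma ReD (a b : C) : complex.Re (a + b) = complex.Re a + complex.Re b.
Proof. by case: a b => [? ?] []. Qed.

Lemma Re_sum (I : finType) (F : I -> C) :
  complex.Re (\sum_i F i) = \sum_i complex.Re (F i).
Proof. exact: (big_morph _ ReD). Qed.

(** The inner product of ['cV[C]_n] seen as a real space of dimension 2n. It induces the same norm
    as the Hermitian product, and its real values keep the later calculus to real functions of a
    real variable. *)
Definition real_dot n (x y : 'cV[C]_n) : R := complex.Re ((x^t* *m y) 0 0).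

Lemma real_dotE n (x y : 'cV[C]_n) : real_dot x y =
  \sum_j (complex.Re (x j 0) * complex.Re (y j 0)
          + complex.Im (x j 0) * complex.Im (y j 0)).
Proof.
rewrite /real_dot mxE Re_sum; apply: eq_bigr => j _; rewrite !mxE.
by case: (x j 0) => a b; case: (y j 0) => c d /=; rewrite mulNr opprK.
Qed.

Lemma real_dotxx n (x : 'cV[C]_n) : real_dot x x = ⟦x⟧ ^+ 2.
Proof.
rewrite real_dotE sqr_sqrtr; first by apply: eq_bigr => j _; rewrite -!expr2.
by apply: sumr_ge0 => j _; rewrite addr_ge0 ?sqr_ge0.
Qed.

Lemma real_dotC n (x y : 'cV[C]_n) : real_dot x y = real_dot y x.
Proof.
by rewrite !real_dotE; apply: eq_bigr => j _; congr (_ + _); rewrite mulrC.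
Qed.

Lemma real_dotDr n (x y z : 'cV[C]_n) :
  real_dot x (y + z) = real_dot x y + real_dot x z.
Proof. by rewrite /real_dot mulmxDr mxE ReD. Qed.

Lemma real_dotZr n (a : R) (x y : 'cV[C]_n) :
  real_dot x (a%:C%C *: y) = a * real_dot x y.
Proof.
rewrite /real_dot -scalemxAr mxE; case: ((_ *m _) 0 0) => c d /=.
by rewrite mul0r subr0.
Qed.

Lemma real_dotNr n (x y : 'cV[C]_n) : real_dot x (- y) = - real_dot x y.
Proof. by rewrite /real_dot mulmxN mxE; case: ((_ *m _) 0 0). Qed.

Lemma real_dotBr n (x y z : 'cV[C]_n) :
  real_dot x (y - z) = real_dot x y - real_dot x z.
Proof. by rewrite real_dotDr real_dotNr. Qed.

Lemma real_dot_adjoint m n (M : 'M[C]_(m, n)) x y :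
  real_dot (M *m x) y = real_dot x (M^t* *m y).
Proof. by rewrite /real_dot trmx_mul map_mxM mulmxA. Qed.

Lemma euclidean_norm_ge0 n (x : 'cV[C]_n) : 0 <= ⟦x⟧.
Proof. exact: sqrtr_ge0. Qed.

Lemma euclidean_norm0_eq0 n (x : 'cV[C]_n) : ⟦x⟧ = 0 -> x = 0.
Proof.
move=> x0; have : real_dot x x = 0 by rewrite real_dotxx x0 expr0n.
rewrite real_dotE => /eqP; rewrite psumr_eq0 => [/allP H|j _]; last first.
  by rewrite addr_ge0 // -expr2 sqr_ge0.
apply/colP => j; have := H j (mem_index_enum _); rewrite implyTb !mxE.
case: (x j 0) => a b /=.
rewrite paddr_eq0 -?expr2 ?sqr_ge0 // !sqrf_eq0.
by case/andP => /eqP-> /eqP->.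
Qed.

Lemma euclidean_norm0 n : ⟦0 : 'cV[C]_n⟧ = 0.
Proof.
rewrite /euclidean_norm big1 ?sqrtr0 // => j _.
by rewrite mxE /= expr0n addr0.
Qed.

Lemma euclidean_normZ n (a : R) (x : 'cV[C]_n) : ⟦a%:C%C *: x⟧ = `|a| * ⟦x⟧.
Proof.
apply/eqP; rewrite -(@eqrXn2 _ 2) ?mulr_ge0 ?euclidean_norm_ge0 //; apply/eqP.
rewrite -real_dotxx real_dotZr real_dotC real_dotZr real_dotxx exprMn.
by rewrite real_normK ?num_real // mulrA expr2.
Qed.

(** Cauchy-Schwarz. For nonzero x and y, expand the nonnegative square of the norm of |y| x - |x| y:
    it equals 2 |x| |y| (|x| |y| - <x, y>). *)
Lemma real_dot_le n (x y : 'cV[C]_n) : real_dot x y <= ⟦x⟧ * ⟦y⟧.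
Proof.
have [x0|x0] := eqVneq ⟦x⟧ 0.
  rewrite x0 (euclidean_norm0_eq0 x0) real_dotE big1 ?mul0r // => j _.
  by rewrite mxE /= !mul0r addr0.
have [y0|y0] := eqVneq ⟦y⟧ 0.
  rewrite y0 (euclidean_norm0_eq0 y0) real_dotE big1 ?mulr0 // => j _.
  by rewrite mxE /= !mulr0 addr0.
have pos : 0 < ⟦x⟧ * ⟦y⟧ by rewrite mulr_gt0 // lt_def ?x0 ?y0 euclidean_norm_ge0.
set z := ⟦y⟧%:C%C *: x - ⟦x⟧%:C%C *: y.
have : 0 <= real_dot z z by rewrite real_dotxx sqr_ge0.
rewrite {2}/z real_dotBr !real_dotZr ![real_dot z _]real_dotC /z !real_dotBr.
rewrite !real_dotZr !real_dotxx (real_dotC y x).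
have -> : ⟦y⟧ * (⟦y⟧ * ⟦x⟧ ^+ 2 - ⟦x⟧ * real_dot x y)
   - ⟦x⟧ * (⟦y⟧ * real_dot x y - ⟦x⟧ * ⟦y⟧ ^+ 2)
   = 2 * (⟦x⟧ * ⟦y⟧) * (⟦x⟧ * ⟦y⟧ - real_dot x y) by ring.
by rewrite (pmulr_rge0 _ (mulr_gt0 (ltr0Sn _ 1) pos)) subr_ge0.
Qed.

Lemma euclidean_normD n (x y : 'cV[C]_n) : ⟦x + y⟧ <= ⟦x⟧ + ⟦y⟧.
Proof.
rewrite -ler_sqr ?nnegrE ?addr_ge0 ?euclidean_norm_ge0 //.
rewrite -real_dotxx real_dotDr ![real_dot (x + y) _]real_dotC !real_dotDr.
rewrite !real_dotxx (real_dotC y x) sqrrD addrA lerD2r -addrA lerD2l.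
by rewrite -mulr2n lerMn2r real_dot_le.
Qed.

Lemma euclidean_distC n (x y : 'cV[C]_n) : ⟦x - y⟧ = ⟦y - x⟧.
Proof.
rewrite -opprB -scaleN1r; have -> : -1 = (-1)%:C%C :> C by rewrite rmorphN.
by rewrite euclidean_normZ normrN1 mul1r.
Qed.

Lemma euclidean_norm_unitary n (P : 'M[C]_n) x :
  P \is unitarymx -> ⟦P *m x⟧ = ⟦x⟧.
Proof.
move=> PU; apply/eqP; rewrite -(@eqrXn2 _ 2) ?euclidean_norm_ge0 //; apply/eqP.
rewrite -!real_dotxx real_dot_adjoint mulmxA -[X in _ *m X *m _]trmxCK.
by rewrite (unitarymxP _) ?trmxC_unitary // mul1mx.
Qed.

End EuclideanSpace.

(** * The spectral norm as a finite supremum *)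

Section SpectralNorm.
Variable R : realType.
Local Notation C := R[i].

Lemma norm_Re_le n (x : 'cV[C]_n) j : `|complex.Re (x j 0)| <= ⟦x⟧.
Proof.
rewrite -sqrtr_sqr ler_wsqrtr // (bigD1 j) //= -addrA lerDl.
by rewrite addr_ge0 ?sqr_ge0 // sumr_ge0 // => k _; rewrite addr_ge0 ?sqr_ge0.
Qed.

Lemma norm_Im_le n (x : 'cV[C]_n) j : `|complex.Im (x j 0)| <= ⟦x⟧.
Proof.
rewrite -sqrtr_sqr ler_wsqrtr // (bigD1 j) //= addrAC lerDr.
by rewrite addr_ge0 ?sqr_ge0 // sumr_ge0 // => k _; rewrite addr_ge0 ?sqr_ge0.
Qed.

(** Expand M x along the columns of M. Each coefficient is split into real and imaginary parts,
    because [euclidean_normZ] is about real scalars; this is why each column is counted twice in the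
    constant. *)
Lemma mulmx_bounded m n (M : 'M[C]_(m, n)) :
  exists2 c : R, 0 <= c & forall x : 'cV[C]_n, ⟦M *m x⟧ <= c * ⟦x⟧.
Proof.
exists (\sum_j (⟦col j M⟧ + ⟦'i%C *: col j M⟧)).
  by apply: sumr_ge0 => j _; rewrite addr_ge0 ?euclidean_norm_ge0.
move=> x; have -> : M *m x = \sum_j x j 0 *: col j M.
  by apply/colP => k; rewrite mxE summxE; apply: eq_bigr => j _; rewrite !mxE mulrC.
rewrite mulr_suml; elim/big_ind2: _ => [|u a v b ua vb|j _].
- by rewrite euclidean_norm0.
- exact: le_trans (euclidean_normD _ _) (lerD ua vb).
rewrite [x j 0]complexE scalerDl mulrC -scalerA mulrDl.
apply: le_trans (euclidean_normD _ _) _; rewrite !euclidean_normZ ![_ * ⟦x⟧]mulrC.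
by rewrite lerD // ler_wpM2r ?euclidean_norm_ge0 ?norm_Re_le ?norm_Im_le.
Qed.

Lemma norm_mulmx_has_sup m n (M : 'M[C]_(m, n)) :
  has_sup [set ⟦M *m x⟧ | x in [set x : 'cV[C]_n | ⟦x⟧ <= 1]]%classic.
Proof.
have [c c0 cM] := mulmx_bounded M; split.
  by exists ⟦M *m 0⟧, 0 => //=; rewrite euclidean_norm0 ler01.
by exists c => _ [x /= x1 <-]; apply: le_trans (cM x) _; rewrite ler_piMr.
Qed.

Lemma spectral_norm_ge0 m n (M : 'M[C]_(m, n)) : 0 <= spectral_norm M.
Proof.
apply: ub_le_sup; first by case: (norm_mulmx_has_sup M).
exists 0 => /=; first by rewrite euclidean_norm0 ler01.
by rewrite mulmx0 euclidean_norm0.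
Qed.

Lemma le_spectral_norm m n (M : 'M[C]_(m, n)) x :
  ⟦M *m x⟧ <= spectral_norm M * ⟦x⟧.
Proof.
have [x0|x0] := eqVneq ⟦x⟧ 0.
  by rewrite x0 (euclidean_norm0_eq0 x0) mulmx0 euclidean_norm0 mulr0.
have x_gt0 : 0 < ⟦x⟧ by rewrite lt_def x0 euclidean_norm_ge0.
rewrite -ler_pdivrMr //; apply: ub_le_sup; first by case: (norm_mulmx_has_sup M).
exists (⟦x⟧^-1%:C%C *: x) => /=.
  by rewrite euclidean_normZ ger0_norm ?invr_ge0 ?euclidean_norm_ge0 // mulVf.
by rewrite -scalemxAr euclidean_normZ ger0_norm ?invr_ge0 ?euclidean_norm_ge0 // mulrC.
Qed.

Lemma spectral_norm_le m n (M : 'M[C]_(m, n)) (c : R) : 0 <= c ->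
  (forall x, ⟦M *m x⟧ <= c * ⟦x⟧) -> spectral_norm M <= c.
Proof.
move=> c0 H; apply: ge_sup; first by case: (norm_mulmx_has_sup M).
by move=> _ [x /= x1 <-]; apply: le_trans (H x) _; rewrite ler_piMr.
Qed.

End SpectralNorm.

(** * Singular values and a one-sided Weyl inequality *)

Section Weyl.
Variable R : rcfType.
Local Notation C := R[i].

(** Diagonalise A^* A in a unitary eigenbasis Q. The sorted singular values are a permutation p of
    the roots of the eigenvalues, so permuting the rows of Q by p puts coordinate j against the j-th
    singular value. *)
Lemma sqr_norm_mulmx_singular_values m n (A : 'M[C]_(m, n)) :
  exists2 P : 'M[C]_n, P \is unitarymx &
  forall x, ⟦A *m x⟧ ^+ 2 =
    \sum_j singular_value A j ^+ 2 *
      (complex.Re ((P *m x) j 0) ^+ 2 + complex.Im ((P *m x) j 0) ^+ 2).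
Proof.
set D := spectral_diag (A ^t* *m A); set Q := spectralmx (A ^t* *m A).
have QU : Q \is unitarymx by exact: spectral_unitarymx.
have E : A ^t* *m A = Q^t* *m diag_mx D *m Q.
  have /orthomx_spectralP := gram_normalmx A; by rewrite -/Q -/D invmx_unitary.
pose s := [tuple Num.sqrt (complex.Re (D 0 j)) | j < n].
have [p sp] : exists p : 'S_n, forall j, singular_value A j = tnth s (p j).
  have : perm_eq (singular_values A) s by apply/permPl/perm_sort.
  move/tuple_permP=> [p Ep]; exists p => j.
  by rewrite /singular_value Ep -tnth_nth tnth_mktuple.
have dE j : D 0 j = (Num.sqrt (complex.Re (D 0 j)) ^+ 2)%:C%C.
  have := spectral_diag_gram_ge0 A j; rewrite -/D; case: (D 0 j) => a b.
  by rewrite lecE /= => /andP[/eqP b0 a0]; rewrite b0 sqr_sqrtr.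
exists (row_perm p Q).
  apply/unitarymxP; rewrite row_permE trmx_mul map_mxM mulmxA.
  rewrite -(mulmxA _ Q) (unitarymxP QU) mulmx1.
  by rewrite tr_perm_mx map_perm_mx -perm_mxM mulgV perm_mx1.
move=> x; rewrite -real_dotxx real_dot_adjoint mulmxA E -!mulmxA.
rewrite -real_dot_adjoint real_dotE.
rewrite (reindex_inj (@perm_inj _ p)); apply: eq_bigr => j _ /=.
have -> : (row_perm p Q *m x) j 0 = (Q *m x) (p j) 0.
  by rewrite row_permE -mulmxA -row_permE mxE.
have -> : (diag_mx D *m (Q *m x)) (p j) 0 =
    (Num.sqrt (complex.Re (D 0 (p j))) ^+ 2)%:C%C * (Q *m x) (p j) 0.
  by rewrite mul_diag_mx mxE -dE.
rewrite sp tnth_mktuple; case: ((Q *m x) (p j) 0) => u v /=; ring.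
Qed.

Lemma singular_value_ge0 m n (A : 'M[C]_(m, n)) i : 0 <= singular_value A i.
Proof.
have : singular_value A i \in singular_values A.
  by rewrite mem_nth // (singular_values_sorted A).2.
rewrite mem_sort => /mapP[j _ ->]; exact: sqrtr_ge0.
Qed.

Lemma singular_value_nonincreasing m n (A : 'M[C]_(m, n)) (i j : 'I_n) :
  (i <= j)%N -> singular_value A j <= singular_value A i.
Proof.
have [so sz] := singular_values_sorted A.
move=> ij; apply: (sorted_leq_nth _ _ 0 so) => //.
- by move=> x y z /= xy yz; exact: le_trans yz xy.
- by move=> x /=.
- by rewrite inE sz.
- by rewrite inE sz.
Qed.

(* The i-th row of the matrix N below is zero, so N x = 0 for some x <> 0.  The
   rows after i make x orthogonal to the singular vectors of A of index > i, and
   those before i make W x orthogonal to the singular vectors of B of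
   index < i. *)
Lemma singular_value_le m1 m2 n (A : 'M[C]_(m1, n)) (B : 'M[C]_(m2, n))
    (W : 'M[C]_n) (c : R) (i : 'I_n) :
  W \is unitarymx ->
  (forall x, ⟦A *m x⟧ <= ⟦B *m (W *m x)⟧ + c * ⟦x⟧) ->
  singular_value A i <= singular_value B i + c.
Proof.
move=> WU H.
have [P PU AP] := sqr_norm_mulmx_singular_values A.
have [Q QU BQ] := sqr_norm_mulmx_singular_values B.
pose N : 'M[C]_n := \matrix_(k, l) if (i < k)%N then P k l else
  if (k < i)%N then (Q *m W) k l else 0.
have [x x0 Nx] : exists2 x : 'cV[C]_n, x != 0 & N *m x = 0.
  have /eqP/det0P[v v0 vN] : \det N^T = 0.
    rewrite det_tr (expand_det_row _ i) big1 // => l _.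
    by rewrite mxE ltnn mul0r.
  exists v^T; first by rewrite -(inj_eq trmx_inj) trmxK trmx0.
  by apply: trmx_inj; rewrite trmx_mul trmxK vN trmx0.
have Px (k : 'I_n) : (i < k)%N -> (P *m x) k 0 = 0.
  move=> ik; have /colP/(_ k) := Nx; rewrite mxE [RHS]mxE => NE.
  rewrite mxE -[RHS]NE.
  by apply: eq_bigr => l _; rewrite [N k l]mxE ik.
have Qx (k : 'I_n) : (k < i)%N -> (Q *m (W *m x)) k 0 = 0.
  move=> ki; have /colP/(_ k) := Nx; rewrite mxE [RHS]mxE => NE.
  rewrite mulmxA mxE -[RHS]NE.
  by apply: eq_bigr => l _; rewrite [N k l]mxE ki ltnNge (ltnW ki).
have x_gt0 : 0 < ⟦x⟧.
  rewrite lt_def euclidean_norm_ge0 andbT; apply: contraNneq x0 => /euclidean_norm0_eq0.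
  by move->.
rewrite -(ler_pM2r x_gt0) mulrDl; apply: (@le_trans _ _ ⟦A *m x⟧); last first.
  (* What remains is |B W x| <= sigma_i(B) |x|: the coordinates of Q W x before i vanish, and the
     others carry weights at most sigma_i(B). *)
  apply: le_trans (H x) _; rewrite lerD2r.
  rewrite -ler_sqr ?nnegrE ?mulr_ge0 ?singular_value_ge0 ?euclidean_norm_ge0 //.
  rewrite BQ exprMn -(euclidean_norm_unitary x WU) -(euclidean_norm_unitary (W *m x) QU).
  rewrite -real_dotxx real_dotE mulr_sumr; apply: ler_sum => k _.
  rewrite -!expr2; have [/Qx->|ik] := ltnP k i.
    by rewrite /= expr0n /= addr0 !mulr0.
  rewrite ler_wpM2r ?addr_ge0 ?sqr_ge0 //.
  by rewrite ler_sqr ?nnegrE ?singular_value_ge0 // singular_value_nonincreasing.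
(* Dually, sigma_i(A) |x| <= |A x|: the coordinates of P x after i vanish, and the others carry
   weights at least sigma_i(A). *)
rewrite -ler_sqr ?nnegrE ?mulr_ge0 ?singular_value_ge0 ?euclidean_norm_ge0 //.
rewrite AP exprMn -(euclidean_norm_unitary x PU).
rewrite -real_dotxx real_dotE mulr_sumr; apply: ler_sum => k _.
rewrite -!expr2; have [/Px->|ik] := ltnP i k.
  by rewrite /= expr0n /= addr0 !mulr0.
rewrite ler_wpM2r ?addr_ge0 ?sqr_ge0 //.
by rewrite ler_sqr ?nnegrE ?singular_value_ge0 // singular_value_nonincreasing.
Qed.

End Weyl.

(** * A Taylor bound and the derivatives of the unitary flows *)

Section UnitaryFlow.
Variable R : realType.
Local Notation C := R[i].

Lemma le_of_derive_le0 (f df : R -> R) :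
  (forall t, is_derive (t : R) (1 : R) f (df t)) ->
  (forall t, 0 <= t -> df t <= 0) ->
  forall t, 0 <= t -> f t <= f 0.
Proof.
move=> fdf df0 t; rewrite le_eqVlt => /predU1P[<-//|t0].
have [|z z0t zE] := @MVT R f df 0 t t0 (fun x _ => fdf x).
  apply: derivable_within_continuous => x _; exact: ex_derive.
have /andP[z0 _] : 0 < z < t by rewrite in_itv in z0t.
by rewrite -subr_le0 zE subr0 mulr_le0_ge0 ?df0 // ltW.
Qed.

(** Subtracting the quadratic f(0) + f'(0) t + c t^2 / 2 leaves [h], with h(0) = 0 and derivative
    [h1], where h1(0) = 0 and h1' <= 0. Monotonicity applied to [h1] and then to [h] gives h(1) <=
    0. *)
Lemma taylor2_le (f df ddf : R -> R) (c : R) :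
  (forall t, is_derive (t : R) (1 : R) f (df t)) ->
  (forall t, is_derive (t : R) (1 : R) df (ddf t)) ->
  (forall t, ddf t <= c) -> f 1 <= f 0 + df 0 + 2^-1 * c.
Proof.
move=> fdf dfddf ddfc.
pose h1 : R -> R := df - cst (df 0) - c *: id.
pose h : R -> R := f - cst (f 0) - df 0 *: id - (2^-1 * c) *: (id * id).
have h1E t : h1 t = df t - df 0 - c * t by [].
have hE t : h t = f t - f 0 - df 0 * t - 2^-1 * c * (t * t) by [].
have dh1 t : is_derive (t : R) (1 : R) h1 (ddf t - c).
  by apply: is_derive_eq; rewrite subr0 /GRing.scale /= mulr1.
have dh t : is_derive (t : R) (1 : R) h (h1 t).
  by apply: is_derive_eq; rewrite subr0 h1E /GRing.scale /= !mulr1; field.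
have h1_le t : 0 <= t -> h1 t <= 0.
  have {2}<- : h1 0 = 0 by rewrite h1E subrr mulr0 subr0.
  by apply: (le_of_derive_le0 dh1) => s _; rewrite subr_le0.
have := le_of_derive_le0 dh h1_le ler01; rewrite !hE; lra.
Qed.

Definition cis (t : R) : C := (cos t +i* sin t)%C.

Lemma cis0 : cis 0 = 1. Proof. by rewrite /cis cos0 sin0. Qed.

Lemma cisD s t : cis (s + t) = cis s * cis t.
Proof. by apply/eqP; rewrite eq_complex /= sinD cosD [X in _ && (X == _)]addrC !eqxx. Qed.

Lemma conj_cis t : (cis t)^* = cis (- t).
Proof. by rewrite /cis cosN sinN. Qed.

Lemma is_derive_cis (z : C) a t :
  is_derive (t : R) (1 : R) (fun t => complex.Re (z * cis (t * a)))
    (complex.Re (z * (0 +i* a)%C * cis (t * a))).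
Proof.
case: z => u v; have -> : (fun s => complex.Re ((u +i* v)%C * cis (s * a))) =
    u *: (cos \o (a *: id)) - v *: (sin \o (a *: id)).
  by apply/funext => s /=; rewrite /cis /= !fctE /= [a *: s]mulrC.
apply: is_derive_eq; rewrite !fctE /GRing.scale /= [t * a]mulrC; ring.
Qed.

Definition cis_diag n (a : 'rV[R]_n) (t : R) : 'M[C]_n :=
  diag_mx (map_mx (fun x => cis (t * x)) a).

Lemma cis_diag_unitary n (a : 'rV[R]_n) t : cis_diag a t \is unitarymx.
Proof.
apply/unitarymxP; rewrite tr_diag_mx map_diag_mx mulmx_diag; apply/matrixP => i j.
rewrite !mxE /= conj_cis -cisD subrr cis0.
by case: eqP.
Qed.

(* exp (t S) for S = P^* diag(i a) P *)
Definition unitary_flow n (P : 'M[C]_n) (a : 'rV[R]_n) (t : R) : 'M[C]_n :=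
  P^t* *m cis_diag a t *m P.

Lemma unitary_flow_unitary n (P : 'M[C]_n) a t :
  P \is unitarymx -> unitary_flow P a t \is unitarymx.
Proof.
move=> PU; have PtU : P^t* \is unitarymx by rewrite (trmxC_unitary P).
exact: (mul_unitarymx (mul_unitarymx PtU (cis_diag_unitary a t)) PU).
Qed.

Lemma unitary_flow0 n (P : 'M[C]_n) a :
  P \is unitarymx -> unitary_flow P a 0 = 1%:M.
Proof.
move=> PU; have -> : 1%:M = P^t* *m P by rewrite -[RHS]mul1mx mulmxA mulmxKtV.
rewrite /unitary_flow; suff -> : cis_diag a 0 = 1%:M by rewrite mulmx1.
by apply/matrixP => i j; rewrite !mxE mul0r cis0.
Qed.

(** S commutes with S^* = -S, hence is normal and unitarily diagonalisable. The diagonal form is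
    again skew-Hermitian, so each eigenvalue has real part zero. *)
Lemma skew_hermitian_diag n (S : 'M[C]_n) : skew_hermitian S ->
  exists2 P, P \is unitarymx &
  exists a : 'rV[R]_n, S = P^t* *m diag_mx (map_mx (fun x => (0 +i* x)%C) a) *m P.
Proof.
move=> hS; have Sn : S \is normalmx.
  by apply/normalmxP; rewrite hS mulNmx mulmxN.
have PU := spectral_unitarymx S.
move/orthomx_spectralP: Sn; rewrite invmx_unitary //.
set P := spectralmx S in PU *; set D := spectral_diag S => E.
exists P => //; exists (map_mx (@complex.Im R) D).
suff <- : D = map_mx (fun x => (0 +i* x)%C) (map_mx (@complex.Im R) D) by [].
have DE : diag_mx D = P *m S *m P^t*.
  by rewrite E !mulmxA (unitarymxP PU) mul1mx -mulmxA (unitarymxP PU) mulmx1.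
have : (diag_mx D)^t* = - diag_mx D.
  by rewrite DE !trmx_mul !map_mxM trmxCK hS mulNmx mulmxN mulmxA.
move=> /matrixP H; apply/rowP => j; have := H j j; rewrite !mxE eqxx !mulr1n.
case: (D 0 j) => u v /= [/eqP]; rewrite -subr_eq0 opprK -mulr2n mulrn_eq0 /=.
by move=> /eqP->.
Qed.

(** In the eigenbases the flow multiplies entry (j, k) of P B Q^* by e^(i t (a_j + b_k)), and B -> S
    B + B T multiplies it by i (a_j + b_k), which is exactly differentiation. With B arbitrary the
    lemma can be iterated to reach the second derivative. *)
Lemma is_derive_unitary_flow m n (P : 'M[C]_m) (Q : 'M[C]_n) a b
   (S : 'M[C]_m) (T : 'M[C]_n) (B : 'M[C]_(m, n)) x y (t : R) :
   P \is unitarymx -> Q \is unitarymx ->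
   S = P^t* *m diag_mx (map_mx (fun x => (0 +i* x)%C) a) *m P ->
   T = Q^t* *m diag_mx (map_mx (fun x => (0 +i* x)%C) b) *m Q ->
   is_derive t (1 : R)
     (fun t => real_dot y (unitary_flow P a t *m B *m unitary_flow Q b t *m x))
     (real_dot y (unitary_flow P a t *m (S *m B + B *m T) *m unitary_flow Q b t *m x)).
Proof.
move=> PU QU SE TE.
have dotE B' s : real_dot y (unitary_flow P a s *m B' *m unitary_flow Q b s *m x) =
  \sum_j \sum_k complex.Re
    (((P *m y) j 0)^* * (P *m B' *m Q^t*) j k * (Q *m x) k 0
     * cis (s * (a 0 j + b 0 k))).
  have regroup (D1 : 'M_m) (D2 : 'M_n) :
      P^t* *m D1 *m P *m B' *m (Q^t* *m D2 *m Q) *m x =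
      P^t* *m (D1 *m (P *m B' *m Q^t*) *m D2 *m (Q *m x)) by rewrite !mulmxA.
  rewrite /unitary_flow regroup -real_dot_adjoint.
  move: (P *m y) (Q *m x) (P *m B' *m Q^t*) => y' x' B1.
  rewrite /real_dot mxE Re_sum; apply: eq_bigr => j _.
  rewrite [(_ *m x') j 0]mxE mulr_sumr Re_sum; apply: eq_bigr => k _.
  rewrite mul_diag_mx mul_mx_diag !mxE mulrDr cisD; congr complex.Re => /=; ring.
have E : P *m (S *m B + B *m T) *m Q^t* =
    \matrix_(j, k) ((P *m B *m Q^t*) j k * (0 +i* (a 0 j + b 0 k))%C).
  have PS : P *m S = diag_mx (map_mx (fun x => (0 +i* x)%C) a) *m P.
    by rewrite SE !mulmxA (unitarymxP PU) mul1mx.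
  have TQ : T *m Q^t* = Q^t* *m diag_mx (map_mx (fun x => (0 +i* x)%C) b).
    by rewrite TE mulmxtVK.
  rewrite mulmxDr mulmxDl mulmxA PS -!mulmxA TQ !mulmxA -!(mulmxA (diag_mx _)).
  rewrite mul_diag_mx mul_mx_diag; apply/matrixP => j k.
  move: (P *m B *m _) => B1.
  rewrite !mxE; case: (B1 j k) => u v; apply/eqP; rewrite eq_complex /=.
  by apply/andP; split; apply/eqP; ring.
under [X in is_derive _ _ X]eq_fun do rewrite dotE.
rewrite dotE E.
have -> : (fun s : R => \sum_j \sum_k complex.Re
     (((P *m y) j 0)^* * (P *m B *m Q^t*) j k * (Q *m x) k 0 * cis (s * (a 0 j + b 0 k))))
  = \sum_j \sum_k (fun s : R => complex.Re
     (((P *m y) j 0)^* * (P *m B *m Q^t*) j k * (Q *m x) k 0 * cis (s * (a 0 j + b 0 k)))).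
  by apply/funext => s; rewrite fct_sumE; apply: eq_bigr => j _; rewrite fct_sumE.
apply: is_derive_sum => j; apply: is_derive_sum => k.
apply: is_derive_eq; first exact: is_derive_cis.
rewrite mxE; congr complex.Re; ring.
Qed.

End UnitaryFlow.

(** * The perturbation bound *)

Theorem mainTheorem8 (R : realType) (m n : nat) (hmn : (n <= m)%N)
    (A : 'M[R[i]]_(m, n)) (S1 : 'M[R[i]]_m) (S2 : 'M[R[i]]_n)
    (hS1 : skew_hermitian S1) (hS2 : skew_hermitian S2)
    (E : 'M[R[i]]_(m, n)) (hE : E = S1 *m A + A *m S2) :
  (forall i : 'I_n,
     `|singular_value (A + E) i - singular_value A i|
     <= 2^-1 * spectral_norm (S1 ^+ 2 *m A + 2 *: (S1 *m A *m S2) + A *m S2 ^+ 2))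
  /\
  2^-1 * spectral_norm (S1 ^+ 2 *m A + 2 *: (S1 *m A *m S2) + A *m S2 ^+ 2)
  <= 2^-1 * spectral_norm E * (spectral_norm S1 + spectral_norm S2).
Proof.
have -> : S1 ^+ 2 *m A + 2 *: (S1 *m A *m S2) + A *m S2 ^+ 2 = S1 *m E + E *m S2.
  by rewrite hE mulmxDr mulmxDl !expr2 -!mulmxE !mulmxA scaler_nat mulr2n !addrA.
set K := spectral_norm _.
split; last first.
  rewrite -mulrA ler_pM2l ?invr_gt0 // mulrC.
  apply: spectral_norm_le => [|x].
    by rewrite mulr_ge0 ?addr_ge0 ?spectral_norm_ge0.
  rewrite mulmxDl !mulrDl; apply: le_trans (euclidean_normD _ _) _.
  rewrite -!mulmxA -mulrA (mulrC (spectral_norm S2)) -mulrA lerD //.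
    apply: le_trans (le_spectral_norm _ _) _.
    by rewrite ler_wpM2l ?spectral_norm_ge0 ?le_spectral_norm.
  apply: le_trans (le_spectral_norm _ _) _.
  by rewrite ler_wpM2l ?spectral_norm_ge0 ?le_spectral_norm.
have [P PU [a S1E]] := skew_hermitian_diag hS1.
have [Q QU [b S2E]] := skew_hermitian_diag hS2.
pose U := unitary_flow P a; pose V := unitary_flow Q b.
have UU t : U t \is unitarymx by exact: unitary_flow_unitary.
have VU t : V t \is unitarymx by exact: unitary_flow_unitary.
have dUV := is_derive_unitary_flow _ _ _ _ PU QU S1E S2E.
have remainder x : ⟦U 1 *m A *m V 1 *m x - (A + E) *m x⟧ <= 2^-1 * K * ⟦x⟧.
  (* The remainder is tested against itself: an upper bound on <y, y> by |y| times the claimed bound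
     suffices, after which |y| cancels. *)
  set y := _ - _; have [->|y0] := eqVneq ⟦y⟧ 0.
    by rewrite !mulr_ge0 ?invr_ge0 ?spectral_norm_ge0 ?euclidean_norm_ge0.
  have y_gt0 : 0 < ⟦y⟧ by rewrite lt_def y0 euclidean_norm_ge0.
  rewrite -(ler_pM2l y_gt0) -expr2 -real_dotxx {2}/y.
  have := taylor2_le (dUV A x y) (dUV _ x y) (c := ⟦y⟧ * (K * ⟦x⟧)) _.
  rewrite -hE !unitary_flow0 // !mul1mx !mulmx1 => taylor.
  rewrite real_dotBr lerBlDl mulmxDl real_dotDr.
  have -> : ⟦y⟧ * (2^-1 * K * ⟦x⟧) = 2^-1 * (⟦y⟧ * (K * ⟦x⟧)) by ring.
  apply: taylor => t.
  apply: le_trans (real_dot_le _ _) _.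
  rewrite ler_wpM2l ?euclidean_norm_ge0 //.
  (* U(t) drops out of the norm and |V(t) x| = |x|, so the second derivative is bounded uniformly in
     t. *)
  rewrite -/(U t) -/(V t) -2!mulmxA (euclidean_norm_unitary _ (UU t)).
  rewrite -(euclidean_norm_unitary x (VU t)); exact: le_spectral_norm.
clear dUV; clearbody U V.
have V1VK x : V 1 *m ((V 1)^t* *m x) = x by rewrite mulmxA (unitarymxP (VU 1)) mul1mx.
have V1U : (V 1)^t* \is unitarymx by rewrite (trmxC_unitary (V 1)); exact: VU.
(* The invariance of singular values under U(1) and V(1) enters implicitly: U(1) leaves norms
   unchanged, and the right factor is absorbed by taking W = V(1)^* in one direction and W = V(1) in
   the other. *)
move=> i; rewrite distrC ler_distlC; apply/andP; split.
  rewrite lerBlDr; apply: (singular_value_le i V1U) => x; set z := (V 1)^t* *m x.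
  have zx : ⟦z⟧ = ⟦x⟧ by rewrite (euclidean_norm_unitary _ V1U).
  have -> : ⟦A *m x⟧ = ⟦U 1 *m A *m V 1 *m z⟧.
    by rewrite -2!mulmxA (euclidean_norm_unitary _ (UU 1)) V1VK.
  rewrite -zx [leRHS]addrC -[U 1 *m A *m V 1 *m z](subrK ((A + E) *m z)).
  by apply: le_trans (euclidean_normD _ _) _; rewrite lerD2r.
apply: (singular_value_le i (VU 1)) => x.
have -> : ⟦A *m (V 1 *m x)⟧ = ⟦U 1 *m A *m V 1 *m x⟧.
  by rewrite -2!mulmxA (euclidean_norm_unitary _ (UU 1)).
rewrite -[(A + E) *m x](subrK (U 1 *m A *m V 1 *m x)) [leRHS]addrC.
apply: le_trans (euclidean_normD _ _) _.
by rewrite lerD2r euclidean_distC.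
Qed.
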